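(* Every vertex identifying code of the infinite hexagonal grid $H$ has density at least $12/29$.
   Context: The infinite hexagonal grid $H$ is the infinite 3-regular planar graph formed by the vertices and edges of the tiling of the plane by regular hexagons. For a vertex $v$, $N[v]$ denotes the closed neighborhood of $v$ ($v$ together with its neighbors). A (vertex) identifying code is a set $\mathcal{D}\subseteq V(H)$ such that for any two distinct vertices $u,v\in V(H)$ the sets $N[u]\cap\mathcal{D}$ and $N[v]\cap\mathcal{D}$ are nonempty and distinct. The density of $\mathcal{D}$ is $\limsup_{h\to\infty}|\mathcal{D}\cap V_h|/|V_h|$, where $V_h$ is the set of vertices at distance at most $h$ from a fixed vertex $v$. *)

(* Defs.v *)
From HB Require Import structures.
From mathcomp Require Import all_boot all_order all_algebra finmap zify.
From mathcomp Require Import all_classical all_reals all_analysis.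

Set Implicit Arguments.
Unset Strict Implicit.
Unset Printing Implicit Defensive.

Import Order.TTheory GRing.Theory Num.Theory.
Local Open Scope classical_set_scope.
Local Open Scope ring_scope.

Section Graph.
Variables (V : choiceType) (e : rel V).

Definition closed_nbhd (v : V) : set V := [set u | u == v \/ e v u].

Definition identifying_code (D : set V) : Prop :=
  forall u v : V, u <> v ->
    [/\ closed_nbhd u `&` D !=set0,
        closed_nbhd v `&` D !=set0
      & closed_nbhd u `&` D <> closed_nbhd v `&` D].

(* [path e v p] says that [v :: p] is a walk with [size p] edges, so this is
   the set of vertices at graph distance at most [h] from [v]. *)
Definition dball (v : V) (h : nat) : set V :=
  [set u | exists p : seq V, [/\ path e v p, last v p = u & (size p <= h)%N]].

(* [fset_set A] is the finite set of elements of [A] when [A] is finite (and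
   empty otherwise), so this is meaningful for locally finite graphs only. *)
Definition density (R : realType) (v : V) (D : set V) : \bar R :=
  limn_esup (fun h : nat =>
    ((#|` fset_set (D `&` dball v h)|%:R / #|` fset_set (dball v h)|%:R : R)%:E)).

End Graph.

(* Let d1, d2, d3 be unit vectors of the plane with d1 + d2 + d3 = 0.  The
   vertices of a tiling by regular hexagons of side 1 are the points
     (a, b, false) |-> a (d1 - d2) + b (d1 - d3)
     (a, b, true)  |-> a (d1 - d2) + b (d1 - d3) + d1     (a, b integers),
   and the edges join each point p of the first kind to p + d1, p + d2, p + d3,
   that is, (a, b, false) to (a, b, true), (a - 1, b, true), (a, b - 1, true). *)
Definition hexV : choiceType := (int * int * bool)%type.

Definition hex_up (u v : hexV) : bool :=
  let: (a, b, s) := u in let: (c, d, t) := v in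
  [&& ~~ s, t & (c, d) \in [:: (a, b); (a - 1, b); (a, b - 1)]].

Definition hex_adj : rel hexV := fun u v => hex_up u v || hex_up v u.

Lemma hex_adj_sym : symmetric hex_adj.
Proof. by move=> u v; rewrite /hex_adj orbC. Qed.

Lemma hex_adj_irr : irreflexive hex_adj.
Proof. by move=> [[a b] []]; rewrite /hex_adj /= ?andbF. Qed.

Definition hex_nbrs (u : hexV) : seq hexV :=
  let: (a, b, s) := u in
  if s then [:: (a, b, false); (a + 1, b, false); (a, b + 1, false)]
  else [:: (a, b, true); (a - 1, b, true); (a, b - 1, true)].

Lemma hex_adjE (u v : hexV) : hex_adj u v = (v \in hex_nbrs u).
Proof.
case: u v => [[a b] s] [[c d] t]; rewrite /hex_adj /hex_nbrs /=.
case: s t => [] []; rewrite /= ?orbF ?inE !xpair_eqE /= ?andbF ?andbT //; lia.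
Qed.

Lemma hex_nbrs_uniq (u : hexV) : uniq (hex_nbrs u).
Proof.
by case: u => [[a b] []]; rewrite /= !inE !xpair_eqE /= ?andbT; lia.
Qed.

Lemma finite_hex_dball (v : hexV) (h : nat) : finite_set (dball hex_adj v h).
Proof.
elim: h => [|h IH].
  apply: (@sub_finite_set _ _ [set v]); last exact: finite_set1.
  by move=> u [p [_ <-]]; rewrite leqn0 size_eq0 => /eqP ->.
apply: (@sub_finite_set _ _ (dball hex_adj v h `|`
    \bigcup_(w in dball hex_adj v h) [set` hex_nbrs w])).
  move=> u [p]; case: (lastP p) => [|q x] [].
    by move=> _ <- _; left; exists [::].
  rewrite rcons_path last_rcons size_rcons ltnS hex_adjE => /andP[hq hx] <- hs.
  by right; exists (last v q) => //; exists q.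
rewrite finite_setU; split => //; apply: bigcup_finite => // w _.
Qed.

(* Main.v *)
(* Discharging, in units of 1/29.  Every vertex outside the code needs 12 units
   and every code vertex has 17 to spare.  It first pays 12/k to each neighbour outside
   the code with k code neighbours; then finitely many translation-invariant
   transfers, each triggered by a partial pattern of the code, make up for the
   deficit this leaves at some isolated code vertices.  The transfers
   were found by linear programming over the patterns of the ball of radius 3.
   Being an identifying code is a hitting-set condition there, and a branching
   search over the 19 vertices of that ball shows that no final charge is
   negative.  Summing over a large ball, the transfers cancel up to its
   boundary; balls grow quadratically, so the boundary is negligible for
   infinitely many radii, which is enough for a limit superior. *)
From Stdlib Require Import ZArith.
Require Import Defs.
From mathcomp Require Import all_boot all_order all_algebra.
From mathcomp Require Import all_classical all_reals all_analysis.
From mathcomp Require Import finmap ssrZ zify ring lra.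
Import Order.TTheory GRing.Theory Num.Theory.
Local Open Scope classical_set_scope.
Local Open Scope ring_scope.

Set Implicit Arguments.
Unset Strict Implicit.
Unset Printing Implicit Defensive.

(** * Group structure on the hexagonal grid *)

(* The hexagonal grid is the Cayley graph of the group generated by three
   half-turns; [hmul] is its product, so left translations are automorphisms. *)
Definition hmul (u x : hexV) : hexV :=
  let: (a, b, s) := u in let: (c, d, t) := x in
  if s then (a - c, b - d, ~~ t) else (a + c, b + d, t).

Definition hone : hexV := (0, 0, false).

Definition hinv (u : hexV) : hexV :=
  let: (a, b, s) := u in if s then u else (- a, - b, false).

Lemma hmulA (u x y : hexV) : hmul u (hmul x y) = hmul (hmul u x) y.
Proof.
by case: u x y => [[a b] []] [[c d] []] [[e f] []]; congr (_, _, _) => /=; lia.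
Qed.

Lemma hmul1 (u : hexV) : hmul u hone = u.
Proof. by case: u => [[a b] []]; congr (_, _, _) => /=; lia. Qed.

Lemma hmulK (u w : hexV) : hmul (hmul u w) (hinv w) = u.
Proof. by case: u w => [[a b] []] [[c d] []]; congr (_, _, _) => /=; lia. Qed.

Lemma hmul_injl (u : hexV) : injective (hmul u).
Proof.
by move: u => [[a b] []] [[c d] []] [[e f] []] //= [? ?]; congr (_, _, _); lia.
Qed.

Lemma hmul_nbrs (u x : hexV) : hex_nbrs (hmul u x) = map (hmul u) (hex_nbrs x).
Proof.
case: u x => [[a b] []] [[c d] []] /=;
  by repeat (congr (_ :: _) || congr (_, _, _)); lia.
Qed.

Arguments hmul : simpl never.

(** * Branch-and-bound search for nonnegativity under clauses *)

Section Cover.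
Implicit Types (f : nat -> bool) (c : Z * seq (nat * bool)).

(** A cube is a weight with a conjunction of literals; charges are constants plus sums of cubes. *)
Definition cube_sem f c : Z :=
  if all (fun l => f l.1 == l.2) c.2 then c.1 else 0.

(* Only the head of a cube or clause is inspected: this is sound for all lists,
   and loses nothing on lists sorted by variable. *)
Definition assign_cube (i : nat) (b : bool) c (st : Z * seq (Z * seq (nat * bool))) :=
  if c.2 is (j, b') :: l then
    if eqn j i then
      if eqb b' b then
        if l is [::] then (Z.add st.1 c.1, st.2) else (st.1, (c.1, l) :: st.2)
      else st
    else (st.1, c :: st.2)
  else (Z.add st.1 c.1, st.2).

Definition assign_cubes i b acc cs := foldr (assign_cube i b) (acc, [::]) cs.

Definition assign_clause (i : nat) (b : bool) (s : seq nat) (st : option (seq (seq nat))) :=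
  if st is Some cl then
    if s is j :: l then
      if eqn j i then
        if b then Some cl else if l is [::] then None else Some (l :: cl)
      else Some (s :: cl)
    else None
  else None.

Definition assign_clauses i b cl := foldr (assign_clause i b) (Some [::]) cl.

Definition lower_bound (acc : Z) cs : Z := foldr (fun c z => Z.add (Z.min c.1 0) z) acc cs.

(* Branch on the variables [i, ..., i + n - 1], stopping as soon as the charge is
   nonnegative even if all negative cubes still open are satisfied. *)
Fixpoint covered (n i : nat) (acc : Z) (cs : seq (Z * seq (nat * bool)))
    (cl : seq (seq nat)) : bool :=
  if Z.leb 0 (lower_bound acc cs) then true else
  if n is n'.+1 then
    let branch b :=
      if assign_clauses i b cl is Some cl' then
        let st := assign_cubes i b acc cs in covered n' i.+1 st.1 st.2 cl'
      else true in
    if branch true then branch false else false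
  else false.

Lemma assign_cubesP f i acc cs (st := assign_cubes i (f i) acc cs) :
  st.1 + \sum_(c <- st.2) cube_sem f c = acc + \sum_(c <- cs) cube_sem f c.
Proof.
rewrite {}/st; elim: cs => [|[w l] cs IH] //=; rewrite big_cons.
rewrite [RHS]addrCA -IH /assign_cube /cube_sem /=; set st := assign_cubes _ _ _ _.
have addE (a b : Z) : Z.add a b = a + b by [].
case: l => [|[j b] l] /=; first by rewrite addE addrCA addrA.
have [->{j}|_] := @eqnP j i; last by rewrite big_cons addrCA.
case: (f i) b => [] [] //=; rewrite ?add0r //.
all: case: l => [|m l]; first by rewrite addE addrCA addrA.
all: by rewrite big_cons addrCA.
Qed.

(** [None] records a falsified clause, which cannot occur on the branch that follows [f]. *)
Lemma assign_clausesP f i cl : (forall s, s \in cl -> has f s) ->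
  if assign_clauses i (f i) cl is Some cl' then forall s, s \in cl' -> has f s
  else False.
Proof.
elim: cl => [|s cl IH] //= H.
have : forall t, t \in cl -> has f t by move=> t ht; apply: H; rewrite inE ht orbT.
move/IH.
rewrite /assign_clauses -/(assign_clauses i (f i) cl).
case: (assign_clauses i (f i) cl) => //= cl' H'.
have := H s (mem_head _ _); case: s {H} => //= j l.
have [->{j}|_] := @eqnP j i; last first.
  by move=> h t; rewrite inE => /predU1P[->|/H'].
case: (f i) => //=; case: l => //= k l h t.
by rewrite inE => /predU1P[->|/H'].
Qed.

Lemma lower_boundP f acc cs :
  (lower_bound acc cs <= acc + \sum_(c <- cs) cube_sem f c)%O.
Proof.
elim: cs => [|c cs IH]; first by rewrite big_nil addr0.
rewrite big_cons addrCA /=; apply: lerD IH.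
by rewrite /cube_sem; case: ifP => _; lia.
Qed.

(** Follow the branch chosen by [f]: each assignment preserves the total, and the lower bound
    settles the leaf reached. *)
Lemma coveredP f n i acc cs cl : covered n i acc cs cl ->
  (forall s, s \in cl -> has f s) -> 0 <= acc + \sum_(c <- cs) cube_sem f c.
Proof.
elim: n i acc cs cl => [|n IH] i acc cs cl /=.
  case: ifP => // h _ _; exact: le_trans (lower_boundP f acc cs).
case: ifP => [h _ _|_]; first exact: le_trans (lower_boundP f acc cs).
move=> h hcl.
have {h} : (if assign_clauses i (f i) cl is Some cl' then
    let st := assign_cubes i (f i) acc cs in covered n i.+1 st.1 st.2 cl'
  else true) : bool.
  by move: h; case: (f i) => /=; case: ifP.
have := @assign_clausesP f i cl hcl.
case: (assign_clauses i (f i) cl) => // cl' hcl' /IH - /(_ hcl').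
by rewrite assign_cubesP.
Qed.
End Cover.

(** * Words in the generators, transfers and charges *)

Definition gen (i : nat) : hexV := nth hone [:: (0, 0, true); (-1, 0, true); (0, -1, true)] i.

(** Right multiplication by a generator crosses an edge, so [hmul u (ev p)] ends the walk from [u]
    with edge labels [p]. *)
Definition ev (p : seq nat) : hexV := foldr (fun i u => hmul (gen i) u) hone p.

Lemma hmul1l (u : hexV) : hmul hone u = u.
Proof. by case: u => [[a b] []]; rewrite /hmul; congr (_, _, _) => /=; lia. Qed.

Lemma ev_cat (p q : seq nat) : ev (p ++ q) = hmul (ev p) (ev q).
Proof. by elim: p => [|i p IH] /=; [rewrite hmul1l|rewrite IH hmulA]. Qed.

Lemma hex_adj_gen (u : hexV) (i : nat) : (i < 3)%N -> hex_adj u (hmul u (gen i)).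
Proof.
move=> i3; rewrite hex_adjE -{2}[u]hmul1 hmul_nbrs map_f //.
by case: i i3 => [|[|[|]]].
Qed.

Lemma dball_ev (v u : hexV) (h : nat) (p : seq nat) :
  all (fun i => i < 3)%N p ->
  dball hex_adj v h u -> dball hex_adj v (h + size p)%N (hmul u (ev p)).
Proof.
elim: p u h => [|i p IH] u h /=; first by rewrite hmul1 addn0.
move=> /andP[i3 p3] [q [pq lq sq]]; rewrite hmulA -addSnnS.
apply: (IH _ h.+1 p3); exists (rcons q (hmul u (gen i))).
by rewrite rcons_path pq lq hex_adj_gen // last_rcons size_rcons ltnS.
Qed.

Definition transfer : Type := (seq nat * seq (seq nat * bool) * Z)%type.
Definition target (m : transfer) := m.1.1.
Definition pattern (m : transfer) := m.1.2.
Definition amount (m : transfer) := m.2.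

Definition holds (D : hexV -> bool) (v : hexV) (P : seq (seq nat * bool)) : bool :=
  all (fun l => D (hmul v (ev l.1)) == l.2) P.

(* The generators are involutions, so [ev (rev p)] is the inverse of [ev p] and
   the sender of what [v] receives is [hmul v (ev (rev (target m)))]. *)
Definition incoming (m : transfer) : seq (seq nat * bool) :=
  [seq (rev (target m) ++ l.1, l.2) | l <- pattern m].

Lemma holds_incoming D v m :
  holds D v (incoming m) = holds D (hmul v (ev (rev (target m)))) (pattern m).
Proof. by rewrite /holds all_map; apply: eq_all => l /=; rewrite ev_cat hmulA. Qed.

(** Scaling by [N] keeps charges integral: amounts are in units of [1/N]. *)
Definition final_charge (N : Z) (ts : seq transfer) (D : hexV -> bool) (v : hexV) : Z :=
  N * (29 * (D v)%:R - 12) +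
  \sum_(m <- ts) amount m * ((holds D v (incoming m))%:R - (holds D v (pattern m))%:R).

(** * Reduction of the local bound to a finite check *)

Section Window.

(** One word per vertex within distance 3, 1 + 3 + 6 + 9 in all. A product of three distinct
    generators is a half-turn, so such a word and its reversal reach the same vertex. *)
Definition window_words : seq (seq nat) :=
  [:: [::]; [:: 0]; [:: 1]; [:: 2]; [:: 0; 1]; [:: 0; 2]; [:: 1; 0]; [:: 1; 2];
      [:: 2; 0]; [:: 2; 1]; [:: 0; 1; 0]; [:: 0; 1; 2]; [:: 0; 2; 0]; [:: 0; 2; 1];
      [:: 1; 0; 1]; [:: 1; 0; 2]; [:: 1; 2; 1]; [:: 2; 0; 2]; [:: 2; 1; 2]]%N.

Definition window : seq hexV := [seq ev p | p <- window_words].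

Definition encode (P : seq (seq nat * bool)) : seq (nat * bool) :=
  sort (fun k l => k.1 <= l.1)%N [seq (index (ev l.1) window, l.2) | l <- P].

Definition in_window (P : seq (seq nat * bool)) : bool :=
  all (fun l => ev l.1 \in window) P.

(** Index 0 is the centre of the window. The constant [-12 N] of the charge is the initial
    accumulator in [certificate]. *)
Definition cubes (N : Z) (ts : seq transfer) : seq (Z * seq (nat * bool)) :=
  (Z.mul 29 N, [:: (0%N, true)]) ::
  flatten [seq [:: (amount m, encode (incoming m)); (Z.opp (amount m), encode (pattern m))]
          | m <- ts].

Definition nbhd (x : hexV) : seq hexV := x :: hex_nbrs x.

Definition separators (x y : hexV) : seq hexV :=
  [seq z <- nbhd x ++ nbhd y | (z \in nbhd x) (+) (z \in nbhd y)].

(* Closed neighbourhoods of vertices at distance at least 3 are disjoint, so only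
   pairs at distance at most 2 need a separating clause. *)
Definition clauses : seq (seq nat) :=
  [seq sort leq [seq index z window | z <- s] |
    s <- [seq nbhd x | x <- window] ++
         [seq separators x y | x <- window,
            y <- [seq y <- flatten [seq hex_nbrs z | z <- nbhd x] |
                   (index x window < index y window)%N]]
    & all (mem window) s].

Definition well_formed (m : transfer) : bool :=
  [&& in_window (pattern m), in_window (incoming m), Z.leb 0 (amount m),
      (size (target m) <= 4)%N & all (fun i => i < 3)%N (target m)].

Definition certificate (N : Z) (ts : seq transfer) : bool :=
  all well_formed ts && covered 19 0 (Z.opp (Z.mul 12 N)) (cubes N ts) clauses.

Lemma nbhd_hmul v x : nbhd (hmul v x) = map (hmul v) (nbhd x).
Proof. by rewrite /nbhd hmul_nbrs. Qed.

Lemma separators_hmul v x y :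
  separators (hmul v x) (hmul v y) = map (hmul v) (separators x y).
Proof.
rewrite /separators !nbhd_hmul -map_cat filter_map; congr map.
apply: eq_filter => z; rewrite /nbhd /= !inE.
by rewrite !(mem_map (@hmul_injl v)) !(inj_eq (@hmul_injl v)).
Qed.

Lemma closed_nbhdE u z : closed_nbhd hex_adj u z <-> z \in nbhd u.
Proof.
rewrite /closed_nbhd /= hex_adjE inE; split => [[->|->]|/orP[]]; rewrite ?orbT //.
  by left.
by right.
Qed.

Variables (D : set hexV) (hD : identifying_code hex_adj D).

Let Db (u : hexV) : bool := u \in D.

Lemma nbhd_meets u : has Db (nbhd u).
Proof.
(* The code condition speaks of pairs, so a neighbour of [u] serves as second vertex. *)
have [|[z [/closed_nbhdE zu Dz]] _ _] := @hD u (hmul u (gen 0)).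
  by move/esym/eqP; rewrite -{2}[u]hmul1 (inj_eq (@hmul_injl u)).
by apply/hasP; exists z => //; exact/mem_set.
Qed.

Lemma separators_meet u w : u != w -> has Db (separators u w).
Proof.
move=> /eqP /hD[_ _ neq]; apply: contraT => /hasPn none; case: neq.
apply/seteqP; split=> z [/closed_nbhdE zn Dz]; split=> //; apply/closed_nbhdE.
all: apply: contraT => znn; have /none : z \in separators u w.
all: rewrite ?mem_filter ?mem_cat ?zn ?(negbTE znn) ?orbT //.
all: by rewrite /Db mem_set.
Qed.

Variable v : hexV.

Let f (i : nat) : bool := Db (hmul v (nth hone window i)).

Let f_index (x : hexV) : x \in window -> f (index x window) = Db (hmul v x).
Proof. by move=> hx; rewrite /f nth_index. Qed.

Lemma all_encode P : in_window P ->
  all (fun l => f l.1 == l.2) (encode P) = holds Db v P.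
Proof.
move=> hP; rewrite all_sort all_map; apply: eq_in_all => l lP /=.
by rewrite f_index //; exact: (allP hP).
Qed.

(** Translation by [v] carries neighbourhoods and separators in the window to those around [v],
    which the code meets. *)
Lemma clauses_hold s : s \in clauses -> has f s.
Proof.
move=> /mapP[t]; rewrite mem_filter => /andP[/allP tw tin] ->.
have -> : has f (sort leq [seq index z window | z <- t]) = has Db (map (hmul v) t).
  rewrite (eq_has_r (mem_sort _ _)) !has_map; apply: eq_in_has => z zt /=.
  by rewrite f_index //; exact: tw.
move: tin; rewrite mem_cat => /orP[/mapP[x _ ->]|/allpairsPdep[x [y [_ hy ->]]]].
  by rewrite -nbhd_hmul nbhd_meets.
rewrite -separators_hmul separators_meet // (inj_eq (@hmul_injl v)).
by move: hy; rewrite mem_filter => /andP[hy _]; apply: contraTneq hy => ->; rewrite ltnn.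
Qed.

Lemma final_charge_ge0 N ts : certificate N ts -> 0 <= final_charge N ts Db v.
Proof.
move=> /andP[/allP wf /coveredP /(_ clauses_hold)].
rewrite /cubes big_cons big_flatten big_map.
suff -> : \sum_(m <- ts) \sum_(c <-
      [:: (amount m, encode (incoming m)); (Z.opp (amount m), encode (pattern m))])
      cube_sem f c =
    \sum_(m <- ts) amount m * ((holds Db v (incoming m))%:R - (holds Db v (pattern m))%:R).
  have -> : Z.opp (Z.mul 12 N) = - (12%:R * N) by [].
  have -> : Z.mul 29 N = 29%:R * N by [].
  rewrite /final_charge /cube_sem [all _ _]/= andbT /f [nth _ _ _]/= hmul1 addrA.
  by congr (_ <= _ + _); case: (Db v) => /=; ring.
rewrite !big_seq; apply: eq_bigr => m /wf /and5P[wp wi _ _ _].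
rewrite !big_cons big_nil /cube_sem /= !all_encode //.
have -> : Z.opp (amount m) = - amount m by [].
by case: holds; case: holds => /=; ring.
Qed.

End Window.

(** * Limit superior of ratios under quadratic growth *)

Lemma bernoulli (R : realFieldType) (x : R) (k : nat) :
  0 <= x -> 1 + k%:R * x <= (1 + x) ^+ k.
Proof.
move=> x0; elim: k => [|k IH]; first by rewrite mul0r addr0 expr0.
rewrite exprS; apply: le_trans (ler_wpM2l _ IH); last by rewrite addr_ge0.
have : 0 <= k%:R * x * x by rewrite !mulr_ge0.
by rewrite -natr1; lra.
Qed.

(** At exponent [3k], the cube of Bernoulli's bound gives growth at least [(kx)^3], against a bound
    of order [k^2]. *)
Lemma no_exponential_growth (R : realType) (b : nat -> nat) (C d n0 : nat) (x : R) :
  0 < x -> (0 < b n0)%N -> (forall h, (b h <= C * (h + 1) ^ 2)%N) ->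
  (forall h, (n0 <= h)%N -> (1 + x) * (b h)%:R <= (b (h + d)%N)%:R) -> False.
Proof.
move=> x0 b0 bC bx.
have grow k : (1 + x) ^+ k <= (b (n0 + k * d)%N)%:R.
  elim: k => [|k IH]; first by rewrite mul0n addn0 expr0 ler1n.
  rewrite exprS mulSn [(d + _)%N]addnC addnA.
  apply: le_trans (bx _ (leq_addr _ _)); apply: ler_wpM2l IH.
  by rewrite addr_ge0 // ltW.
(* For [k >= 1], the quadratic bound at [n0 + 3kd] is at most [M k^2]. *)
pose M := (C * (n0 + 3 * d + 1) ^ 2)%N.
have lin k : (0 < k)%N -> k%:R * x ^+ 3 <= M%:R.
  move=> k0; have kR : (0 : R) < k%:R by rewrite ltr0n.
  have h1 : (k%:R * x) ^+ 3 <= (M * k ^ 2)%:R.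
    have h2 : (k%:R * x) ^+ 3 <= ((1 + x) ^+ k) ^+ 3.
      have x0' := ltW x0.
      rewrite lerXn2r ?nnegrE ?mulr_ge0 ?exprn_ge0 ?addr_ge0 //.
      by apply: le_trans (bernoulli _ x0'); rewrite lerDr.
    apply: (le_trans h2); rewrite -exprM; apply: (le_trans (grow _)); rewrite ler_nat.
    apply: leq_trans (bC _) _; rewrite /M -[(C * _ * _)%N]mulnA leq_mul2l -expnMn leq_exp2r //.
    by apply/orP; right; nia.
  rewrite -(ler_pM2r (exprn_gt0 2 kR)).
  by move: h1; rewrite natrM natrX; congr (_ <= _); ring.
have x3 : 0 < x ^+ 3 by exact: exprn_gt0.
pose k := (Num.bound (M%:R / x ^+ 3)).+1.
have := lin k isT; rewrite -ler_pdivlMr // leNgt.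
have : M%:R / x ^+ 3 < (Num.bound (M%:R / x ^+ 3))%:R.
  by apply: archi_boundP; rewrite divr_ge0 // ltW.
move=> /lt_trans -> //.
by rewrite ltr_nat.
Qed.

(** If some tail supremum [r] were below [p/q], then with [e = p - rq > 0] the hypothesis would give
    [(K + e) b(h) <= K b(h + d)] on that tail: geometric growth. *)
Lemma limn_esup_ratio_ge (R : realType) (a b : nat -> nat) (p q K C d : nat) :
  (0 < q)%N -> (forall h, (0 < b h)%N) -> (forall h, (b h <= C * (h + 1) ^ 2)%N) ->
  (forall h, (p * b h + K * b h <= q * a h + K * b (h + d))%N) ->
  ((p%:R / q%:R : R)%:E <= limn_esup (fun h => ((a h)%:R / (b h)%:R : R)%:E))%E.
Proof.
move=> q0 b0 bC ab; rewrite /limn_esup limf_esupE; apply: le_ereal_inf_tmp => _ [A [n0 _ An0] <-].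
set u := fun h => _; set s := ereal_sup _.
have us h : (n0 <= h)%N -> (u h <= s)%E.
  by move=> nh; apply: ereal_sup_ubound; exists h => //; exact: An0.
rewrite leNgt; apply/negP => slt.
have sfin : s \is a fin_num.
  rewrite fin_numElt; apply/andP; split; last exact: lt_trans slt (ltry _).
  by apply: lt_le_trans (us n0 (leqnn _)); exact: ltNyr.
pose r := fine s; have rE : s = r%:E by rewrite fineK.
have qR : (0 : R) < q%:R by rewrite ltr0n.
have eps0 : 0 < p%:R - r * q%:R :> R.
  by rewrite subr_gt0 -ltr_pdivlMr //; move: slt; rewrite rE lte_fin.
set e := p%:R - r * q%:R in eps0.
have ineq h : (n0 <= h)%N -> (K%:R + e) * (b h)%:R <= K%:R * (b (h + d)%N)%:R.
  move=> nh; have := us h nh; rewrite rE lee_fin ler_pdivrMr ?ltr0n // => ah.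
  have := ab h; rewrite -(ler_nat R) !natrD !natrM /e => abh.
  have : q%:R * (a h)%:R <= q%:R * (r * (b h)%:R) by rewrite ler_pM2l.
  by lra.
(* The growth rate [e / K] needs [K > 0]; for [K = 0] the inequality already fails. *)
have [K0|K0] := posnP K.
  have := ineq n0 (leqnn _); rewrite K0 add0r mul0r leNgt mulr_gt0 //.
  by rewrite ltr0n.
have KR : (0 : R) < K%:R by rewrite ltr0n.
apply: (@no_exponential_growth R b C d n0 (e / K%:R)) => //.
  by rewrite divr_gt0.
move=> h /ineq; rewrite -ler_pdivrMl // mulrA; congr (_ * _ <= _).
by field; rewrite gt_eqF.
Qed.

(** * Cancellation of transfers up to the boundary *)

Lemma sum_nat_of_bool (T : Type) (P : pred T) (s : seq T) :
  \sum_(x <- s) (P x)%:R = (count P s)%:R :> Z.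
Proof. by elim: s => [|x s IH]; rewrite ?big_nil // big_cons IH /= natrD. Qed.

(** The left count is at most the count of [P] on [B'], and the part of [B'] outside [B] adds at
    most its size. *)
Lemma count_comp_le (T : eqType) (P : pred T) (g : T -> T) (B B' : seq T) :
  injective g -> uniq B -> uniq B' -> {subset B <= B'} -> {subset map g B <= B'} ->
  (count (P \o g) B + size B <= count P B + size B')%N.
Proof.
move=> ginj uB uB' BB' gBB'.
have le1 : (count (P \o g) B <= count P B')%N.
  rewrite -count_map -!size_filter; apply: uniq_leq_size.
    by rewrite filter_uniq // map_inj_uniq.
  by move=> x; rewrite !mem_filter => /andP[-> /gBB'].
have split_B' : perm_eq B' (B ++ [seq x <- B' | x \notin B]).
  apply: uniq_perm => //.
    rewrite cat_uniq uB filter_uniq // andbT -all_predC; apply/allP => x /=.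
    by rewrite mem_filter => /andP[].
  move=> x; rewrite mem_cat mem_filter.
  by case: (boolP (x \in B)) => [/BB' ->|_].
move: le1; rewrite (permP split_B') (perm_size split_B') count_cat size_cat.
have := count_size P [seq x <- B' | x \notin B]; lia.
Qed.

Lemma sum_final_charge_le (N : Z) (ts : seq transfer) (D : pred hexV) (B B' : seq hexV) :
  all well_formed ts -> uniq B -> uniq B' -> {subset B <= B'} ->
  (forall p u, all (fun i => i < 3)%N p -> (size p <= 4)%N -> u \in B -> hmul u (ev p) \in B') ->
  \sum_(v <- B) final_charge N ts D v <=
    N * (29 * (count D B)%:R - 12 * (size B)%:R) +
    (\sum_(m <- ts) amount m) * ((size B')%:R - (size B)%:R).
Proof.
move=> /allP wf uB uB' BB' near.
have base : \sum_(v <- B) N * (29 * (D v)%:R - 12) =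
    N * (29 * (count D B)%:R - 12 * (size B)%:R).
  by rewrite -mulr_sumr sumrB -mulr_sumr sum_nat_of_bool big_const_seq count_predT
             iter_addr_0 [12 * _]mulr_natr.
rewrite /final_charge big_split /= base.
rewrite lerD2l exchange_big /= mulr_suml big_seq [leRHS]big_seq.
apply: ler_sum => m /wf /and5P[_ _ am sm tm].
rewrite -mulr_sumr; apply: ler_wpM2l => //.
rewrite sumrB !sum_nat_of_bool.
(* Right multiplication by [w] takes a receiver to its sender. *)
pose w := ev (rev (target m)).
have winj : injective (hmul ^~ w).
  by apply: (can_inj (g := hmul ^~ (hinv w))) => u; rewrite hmulK.
have wB : {subset [seq hmul u w | u <- B] <= B'}.
  move=> _ /mapP[u uB0 ->]; apply: near => //; last by rewrite size_rev.
  by rewrite all_rev.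
have := count_comp_le (holds D ^~ (pattern m)) winj uB uB' BB' wB.
rewrite (eq_count (a2 := holds D ^~ (incoming m))); last first.
  by move=> v /=; rewrite holds_incoming.
by rewrite -(ler_nat Z) !natrD lerBlDr [X in _ -> _ <= X]addrAC lerBrDr [X in _ -> _ <= X]addrC.
Qed.

(** * Size of balls and the density bound *)

Lemma hex_adj_step (u w : hexV) : hex_adj u w ->
  `|w.1.1 - u.1.1| <= 1 /\ `|w.1.2 - u.1.2| <= 1.
Proof.
rewrite hex_adjE; case: u w => [[a b] []] [[c d] []];
  rewrite /hex_nbrs !inE !xpair_eqE /= ?andbF ?andbT ?orbF //.
all: by case/or3P => /andP[/eqP -> /eqP ->]; split; lia.
Qed.

Lemma dball_box (v u : hexV) (h : nat) : dball hex_adj v h u ->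
  `|u.1.1 - v.1.1| <= h%:Z /\ `|u.1.2 - v.1.2| <= h%:Z.
Proof.
move=> [p [vp <- ph]].
elim: p v h vp ph => [|w p IH] v h /=; first by rewrite !subrr normr0.
case: h => // h /andP[/hex_adj_step[a1 b1] wp] ph.
have [a2 b2] := IH w h wp ph; rewrite -addn1 PoszD.
by split; [apply: le_trans (ler_distD w.1.1 _ _) _|apply: le_trans (ler_distD w.1.2 _ _) _];
  exact: lerD.
Qed.

Lemma natZ (n : nat) : n%:R = Z.of_nat n :> Z.
Proof. by elim: n => // n IH; rewrite -addn1 natrD IH; lia. Qed.

Section Ball.
Variable v : hexV.

Definition ball_seq (h : nat) : seq hexV := fset_set (dball hex_adj v h).

Lemma mem_ball_seq h u : u \in ball_seq h <-> dball hex_adj v h u.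
Proof.
rewrite /ball_seq /= in_fset_set; last exact: finite_hex_dball.
by split=> [/set_mem|/mem_set].
Qed.

Lemma ball_seq_uniq h : uniq (ball_seq h).
Proof. exact: fset_uniq. Qed.

Lemma ball_seq_gt0 h : (0 < size (ball_seq h))%N.
Proof.
have : v \in ball_seq h by apply/mem_ball_seq; exists [::].
by case: (ball_seq h).
Qed.

Lemma size_ball_seq h : (size (ball_seq h) <= 8 * (h + 1) ^ 2)%N.
Proof.
(* The box has [2 (2h + 1)^2] points, at most [8 (h + 1)^2]. *)
pose box := [seq (x, s) | x <- [seq (v.1.1 + i%:Z - h%:Z, v.1.2 + j%:Z - h%:Z) |
  i <- iota 0 (2 * h + 1), j <- iota 0 (2 * h + 1)], s <- [:: true; false]].
have : (size (ball_seq h) <= size box)%N.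
  apply: uniq_leq_size (ball_seq_uniq h) _ => -[[a b] s] /mem_ball_seq /dball_box /= [ha hb].
  apply/allpairsP; exists ((a, b), s); split => //; last by case: s.
  apply/allpairsP; exists (absz (a - v.1.1 + h%:Z), absz (b - v.1.2 + h%:Z)).
  by rewrite /= !mem_iota; split; [lia|lia|congr (_, _); lia].
by move/leq_trans; apply; rewrite !size_allpairs !size_iota /=; nia.
Qed.

Lemma card_dball_setI D h :
  #|` fset_set (D `&` dball hex_adj v h)| = count (fun u => u \in D) (ball_seq h).
Proof.
rewrite -size_filter; apply: perm_size; apply: uniq_perm.
- exact: fset_uniq.
- by rewrite filter_uniq // ball_seq_uniq.
move=> u; rewrite mem_filter in_fset_set; last exact: finite_setIr (finite_hex_dball _ _).
apply/idP/andP => [/set_mem[Du Bu]|[/set_mem Du /mem_ball_seq Bu]].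
  by split; [exact: mem_set|exact/mem_ball_seq].
exact/mem_set.
Qed.

Lemma dball_subset h k u : (h <= k)%N -> dball hex_adj v h u -> dball hex_adj v k u.
Proof. by move=> hk [p [vp lp ph]]; exists p; split=> //; exact: leq_trans ph hk. Qed.

Lemma density_ge (R : realType) (D : set hexV) (N : Z) (ts : seq transfer) :
  identifying_code hex_adj D -> 0 < N -> certificate N ts ->
  ((12%:R / 29%:R : R)%:E <= density hex_adj R v D)%E.
Proof.
move=> hD N0 cert; rewrite /density.
under eq_fun do rewrite card_dball_setI.
(* The boundary constant is the total amount of all transfers, [8] comes from [size_ball_seq], and
   [4] bounds the length of a transfer. *)
apply: (@limn_esup_ratio_ge R _ (fun h => size (ball_seq h)) 12 29
  (Z.to_nat (\sum_(m <- ts) amount m)) 8 4) => // h.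
- exact: ball_seq_gt0.
- exact: size_ball_seq.
have [wf _] := andP cert.
have near p u : all (fun i => i < 3)%N p -> (size p <= 4)%N ->
    u \in ball_seq h -> hmul u (ev p) \in ball_seq (h + 4).
  move=> p3 p4 /mem_ball_seq hu; apply/mem_ball_seq.
  by apply: dball_subset (dball_ev p3 hu); rewrite leq_add2l.
have sub : {subset ball_seq h <= ball_seq (h + 4)}.
  by move=> u /mem_ball_seq hu; apply/mem_ball_seq; apply: dball_subset hu; rewrite leq_addr.
have := @sum_final_charge_le N ts (fun u => u \in D) _ _ wf
  (ball_seq_uniq h) (ball_seq_uniq _) sub near.
have : 0 <= \sum_(u <- ball_seq h) final_charge N ts (fun u => u \in D) u.
  by apply: sumr_ge0 => u _; exact: final_charge_ge0.
have A0 : 0 <= \sum_(m <- ts) amount m.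
  by rewrite big_seq; apply: sumr_ge0 => m /(allP wf) /and5P[].
have := uniq_leq_size (ball_seq_uniq h) sub.
move: (\sum_(m <- ts) amount m) A0 (\sum_(u <- _) _) => A A0 S.
move: (size _) (size _) (count _ _) => b b' a.
rewrite !natZ => bb S0 SA; have {S0 SA} := le_trans S0 SA.
set X := 29 * _ - _ => XA.
have {XA} : 0 <= X + A * (Z.of_nat b - Z.of_nat b').
  have AB : 0 <= A * (Z.of_nat b - Z.of_nat b').
    by apply: mulr_ge0 => //; rewrite subr_ge0; lia.
  have [X0|X0] := leP 0 X; first exact: addr_ge0.
  apply: le_trans XA _; rewrite lerD2r -[leRHS]mul1r ler_nM2r //; lia.
rewrite /X; lia.
Qed.
End Ball.

(** * The explicit transfers and the conclusion *)

(* A rule [(b, w, ins, outs, y)] sends [y] from [u] to [u w] when the [u p] with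
   [p] in [ins] are in the code and those with [p] in [outs] are not, together
   with its images under permutations of the three directions; [b] marks the
   rules fixed by a reflection, for which the rotations suffice. *)
Definition rule : Type := (bool * seq nat * seq (seq nat) * seq (seq nat) * positive)%type.

Definition relabelings (b : bool) : seq (seq nat) :=
  [:: [:: 0; 1; 2]; [:: 1; 2; 0]; [:: 2; 0; 1]]%N ++
  if b then [::] else [:: [:: 0; 2; 1]; [:: 1; 0; 2]; [:: 2; 1; 0]]%N.

Definition expand (r : rule) : seq transfer :=
  let: (b, w, ins, outs, y) := r in
  [seq let relabel := map (nth 0%N s) in
       (relabel w,
        [seq (relabel p, true) | p <- ins] ++ [seq (relabel p, false) | p <- outs], Zpos y)
  | s <- relabelings b].

(* Amounts are in units of 1/203 of a unit.  The first three rules are the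
   payments 12/k to vertices outside the code, k = 1, 2, 3. *)
Definition rules : seq rule :=
  [:: (true, [:: 0], [:: [::]], [:: [:: 0]; [:: 0; 1]; [:: 0; 2]], 2436%positive);
      (false, [:: 0], [:: [::]; [:: 0; 2]], [:: [:: 0]; [:: 0; 1]], 1218%positive);
      (true, [:: 0], [:: [::]; [:: 0; 1]; [:: 0; 2]], [:: [:: 0]], 812%positive);
      (false, [:: 0], [:: [:: 0; 1]; [:: 0; 2]; [:: 2; 1]], [:: [:: 1]; [:: 2]; [:: 1; 2]], 86%positive);
      (false, [:: 0; 1], [::], [:: [::]; [:: 0]], 254%positive);
      (false, [:: 0; 1], [::], [:: [::]; [:: 0]; [:: 0; 2]], 201%positive);
      (false, [:: 0; 1], [::], [:: [:: 0; 1]; [:: 0; 2]; [:: 2; 1]; [:: 0; 1; 2]; [:: 0; 2; 0]; [:: 0; 2; 1]; [:: 2; 1; 2]], 169%positive);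
      (false, [:: 0; 1], [:: [:: 1]], [:: [:: 0]; [:: 0; 2]; [:: 2; 1]; [:: 0; 1; 2]; [:: 0; 2; 1]; [:: 2; 1; 2]], 166%positive);
      (false, [:: 0; 1], [:: [:: 0]; [:: 1]; [:: 0; 1; 0]], [:: [::]; [:: 2]; [:: 0; 1; 2]], 154%positive);
      (false, [:: 0; 1], [::], [:: [:: 0; 1]], 114%positive);
      (false, [:: 0; 1], [:: [:: 1]; [:: 2]; [:: 0; 1; 0]; [:: 0; 1; 2]], [:: [:: 0; 2]; [:: 0; 2; 0]], 100%positive);
      (false, [:: 0; 1], [:: [::]; [:: 0]; [:: 2]; [:: 0; 2; 1]; [:: 2; 1; 2]], [::], 88%positive);
      (false, [:: 0; 1], [:: [:: 1]; [:: 2]; [:: 0; 1; 0]; [:: 0; 1; 2]; [:: 0; 2; 0]], [:: [:: 0; 1]], 78%positive);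
      (false, [:: 0; 1], [::], [:: [:: 0; 1]; [:: 0; 2]], 74%positive);
      (false, [:: 0; 1], [:: [:: 0; 1; 0]; [:: 0; 1; 2]], [:: [:: 0]; [:: 1]; [:: 2]; [:: 0; 1]], 51%positive);
      (false, [:: 0; 1], [:: [:: 1]; [:: 2]; [:: 0; 1]], [:: [:: 0; 1; 2]], 23%positive);
      (false, [:: 0; 1], [:: [:: 2]; [:: 0; 1]; [:: 0; 1; 0]], [::], 21%positive);
      (false, [:: 0; 1; 0], [:: [:: 2; 1]], [:: [:: 0; 1]; [:: 0; 2]; [:: 0; 1; 0]; [:: 0; 1; 2]], 180%positive);
      (false, [:: 0; 1; 0], [::], [:: [::]; [:: 0; 1]; [:: 0; 1; 0]; [:: 0; 1; 2]; [:: 0; 2; 0]], 167%positive);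
      (false, [:: 0; 1; 0], [:: [::]; [:: 0; 1]], [:: [:: 0; 1; 0]], 125%positive);
      (false, [:: 0; 1; 0], [:: [::]; [:: 0]], [:: [:: 0; 1]; [:: 0; 1; 0]], 95%positive);
      (false, [:: 0; 1; 0], [:: [::]; [:: 0]; [:: 0; 2; 0]], [:: [:: 0; 1]; [:: 0; 2]; [:: 0; 1; 2]], 78%positive);
      (false, [:: 0; 1; 0], [:: [:: 2; 1]; [:: 0; 1; 2]; [:: 0; 2; 0]], [:: [::]; [:: 0]; [:: 0; 2]], 53%positive);
      (false, [:: 0; 1; 0], [:: [:: 0]; [:: 0; 2]; [:: 2; 1]; [:: 0; 1; 0]], [:: [:: 0; 1]; [:: 0; 2; 0]], 51%positive);
      (false, [:: 0; 1; 0], [:: [:: 2; 1]; [:: 0; 2; 0]], [:: [:: 0; 1]; [:: 0; 2]; [:: 0; 1; 2]], 51%positive);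
      (false, [:: 0; 1; 0], [:: [:: 0; 2]; [:: 2; 1]; [:: 0; 1; 2]; [:: 0; 2; 0]], [:: [:: 0]; [:: 0; 1; 0]], 45%positive);
      (false, [:: 0; 1; 0], [::], [:: [:: 0; 1]], 41%positive);
      (false, [:: 0; 1; 0], [::], [:: [::]], 23%positive);
      (false, [:: 0; 1; 0], [::], [:: [::]; [:: 0; 2]; [:: 2; 1]; [:: 0; 1; 2]; [:: 0; 2; 0]], 13%positive);
      (false, [:: 0; 1; 0], [::], [:: [::]; [:: 0; 1]; [:: 2; 1]; [:: 0; 1; 0]; [:: 0; 1; 2]; [:: 0; 2; 0]], 12%positive);
      (false, [:: 0; 1; 0], [:: [:: 0]], [:: [::]; [:: 0; 2]; [:: 2; 1]; [:: 0; 1; 2]; [:: 0; 2; 0]], 7%positive);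
      (true, [:: 0; 1; 2], [:: [:: 0; 1]; [:: 0; 2]; [:: 2; 0]; [:: 2; 1]; [:: 0; 1; 2]], [:: [::]], 189%positive);
      (false, [:: 0; 1; 2], [:: [:: 2; 0]; [:: 2; 1; 2]], [:: [::]; [:: 0; 1]; [:: 0; 2]; [:: 2; 1]; [:: 0; 1; 0]], 140%positive);
      (false, [:: 0; 1; 2], [:: [::]; [:: 2; 1]], [:: [:: 0]; [:: 2]; [:: 0; 1]; [:: 0; 1; 2]], 133%positive);
      (false, [:: 0; 1; 2], [:: [:: 0]; [:: 2; 1]], [:: [:: 0; 1; 2]], 113%positive);
      (true, [:: 0; 1; 2], [:: [::]; [:: 0; 1]; [:: 2; 1]], [:: [:: 0; 1; 2]], 102%positive);
      (false, [:: 0; 1; 2], [:: [::]; [:: 0]; [:: 2]], [:: [:: 0; 1]; [:: 0; 1; 2]], 95%positive);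
      (false, [:: 0; 1; 2], [:: [:: 0]; [:: 2; 1]], [:: [:: 0; 1]], 47%positive);
      (false, [:: 0; 1; 2], [:: [:: 0]; [:: 2; 0]; [:: 0; 1; 0]], [:: [:: 2; 1]; [:: 0; 1; 2]], 39%positive);
      (false, [:: 0; 1; 2], [:: [:: 2; 0]; [:: 2; 1]], [:: [:: 0]; [:: 0; 1]; [:: 0; 1; 0]], 38%positive);
      (false, [:: 0; 1; 2], [:: [:: 2; 1]], [:: [:: 0; 1]; [:: 0; 1; 2]], 38%positive);
      (false, [:: 0; 1; 0; 1], [:: [:: 0; 1]; [:: 0; 1; 2]], [:: [:: 0]; [:: 0; 2; 0]], 59%positive);
      (false, [:: 0; 1; 0; 1], [:: [:: 0; 2; 0]], [:: [:: 0; 1; 0]; [:: 0; 1; 2]], 54%positive);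
      (false, [:: 0; 1; 0; 1], [::], [:: [:: 0; 1]; [:: 0; 1; 0]; [:: 0; 1; 2]; [:: 0; 2; 0]], 54%positive) ].

Definition transfers : seq transfer := flatten [seq expand r | r <- rules].

(** The branching search itself, run by computation; [203] is the common denominator of the
    amounts. *)
Lemma certificate_transfers : certificate 203 transfers.
Proof. by vm_compute. Qed.

Theorem theorem1 (R : realType) (v : hexV) (D : set hexV)
    (hD : identifying_code hex_adj D) :
  ((12%:R / 29%:R : R)%:E <= density hex_adj R v D)%E.
Proof. exact: density_ge hD _ certificate_transfers. Qed.
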